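(* There exist tilings of the plane with pairwise noncongruent triangles of unit area, the perimeters of which are bounded from above by a constant. That is, there exist a constant $K>0$ and a family $\mathcal{T}$ of closed nondegenerate triangles in $\mathbb{R}^2$ such that $\bigcup_{T\in\mathcal{T}}T=\mathbb{R}^2$, distinct members of $\mathcal{T}$ have disjoint interiors, no two distinct members of $\mathcal{T}$ are congruent, every $T\in\mathcal{T}$ has area $1$, and every $T\in\mathcal{T}$ has perimeter at most $K$.
   Context: A tiling of the plane is a covering of the plane with closed regions whose interiors are pairwise disjoint. (It is not required that the tiling be edge-to-edge.) Two triangles are congruent if some isometry of the plane, possibly orientation-reversing, maps one onto the other. *)

(* Defs.v *)
(* Library: MathComp-Analysis. *)
From HB Require Import structures.
From mathcomp Require Import all_boot all_order all_algebra.
From mathcomp Require Import all_classical all_reals all_analysis.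

Set Implicit Arguments.
Unset Strict Implicit.
Unset Printing Implicit Defensive.

Import Order.TTheory GRing.Theory Num.Theory.
Import numFieldNormedType.Exports.

Local Open Scope classical_set_scope.
Local Open Scope ring_scope.

(* The plane is [R * R]. Its library topology is the product topology, but its
   library norm is the sup norm; the Euclidean metric is therefore explicit. *)
Definition eucl_dist (R : realType) (p q : R * R) : R :=
  Num.sqrt ((p.1 - q.1) ^+ 2 + (p.2 - q.2) ^+ 2).

Definition plane_isometry (R : realType) (f : R * R -> R * R) : Prop :=
  forall p q, eucl_dist (f p) (f q) = eucl_dist p q.

Definition plane_congruent (R : realType) (S T : set (R * R)) : Prop :=
  exists2 f : R * R -> R * R, plane_isometry f & f @` S = T.

Definition triangle (R : realType) (a b c : R * R) : set (R * R) :=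
  smallest (@convex_set R (R * R)%type) [set a; b; c].

Definition noncollinear (R : realType) (a b c : R * R) : Prop :=
  forall s t : R, s *: (b - a) + t *: (c - a) = 0 -> s = 0 /\ t = 0.

Definition triangle_perimeter (R : realType) (a b c : R * R) : R :=
  eucl_dist a b + eucl_dist b c + eucl_dist c a.

Definition area (R : realType) (T : set (R * R)) : \bar R :=
  (@lebesgue_measure R \x @lebesgue_measure R)%E T.

Definition tiling (R : realType) (TT : set (set (R * R))) : Prop :=
  [/\ (forall T, TT T -> closed T),
      \bigcup_(T in TT) T = setT &
      forall S T, TT S -> TT T -> S <> T -> interior S `&` interior T = set0].

(* Main.v *)
(** Cut the plane into vertical strips of width 2 and each strip into cells by
segments crossing it.  A cell is either a triangle with a side of length 1 on
the left wall, or a trapezoid with parallel sides (5 -+ sqrt 5) / 2, which a fan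
from a point of its lower edge dissects into five triangles of area 1.  Crossing
a triangular cell lowers the rise of the crossing segment by 1, crossing a
trapezoid raises it by sqrt 5; so the two kinds of cells can be alternated with
the rise staying bounded, and by irrationality it never takes the same value
twice.

Finally each strip [k] is sheared by [r_k theta].  The sum of the squared sides
of a triangle is a congruence invariant and is here a quadratic polynomial in
[theta].  A [theta] outside a countable set makes equality of two values imply
equality of coefficients; the leading ones determine the strip and the position
in the cell, and then the linear ones determine the rise, hence the cell. *)

Require Import Defs.
From HB Require Import structures.
From mathcomp Require Import all_boot all_order all_algebra.
From mathcomp Require Import all_classical all_reals all_analysis.
From mathcomp Require Import measurable_realfun zify ring lra.

Set Implicit Arguments.
Unset Strict Implicit.
Unset Printing Implicit Defensive.

Import Order.TTheory GRing.Theory Num.Theory.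
Import numFieldNormedType.Exports.

Local Open Scope classical_set_scope.
Local Open Scope ring_scope.

(** * Triangles, half-planes, interiors *)

Section Triangles.
Variable R : realType.
Implicit Types (a b c p q v : R * R) (S T : set (R * R)).

Definition orient a b c : R :=
  (b.1 - a.1) * (c.2 - a.2) - (b.2 - a.2) * (c.1 - a.1).

Definition barycenter a b c (x y z : R) : R * R :=
  (x * a.1 + y * b.1 + z * c.1, x * a.2 + y * b.2 + z * c.2).

Lemma convex_setE S : @convex_set R (R * R)%type S <->
  forall p q (t : R), S p -> S q -> 0 <= t <= 1 ->
    S (t * p.1 + (1 - t) * q.1, t * p.2 + (1 - t) * q.2).
Proof.
split=> [cS p q t Sp Sq /andP[t0 t1]|cS p q t].
  have tP : Itv.spec (@Itv.num_sem R) (Itv.Real `[0%Z, 1%Z]) t.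
    by apply/and3P; split; rewrite ?num_real//= bnd_simp.
  by have := cS p q (Itv.mk tP) (mem_set Sp) (mem_set Sq); rewrite inE.
rewrite !inE => Sp Sq; have := cS p q t%:num Sp Sq; apply.
by apply/andP; split.
Qed.

Lemma triangleE a b c : triangle a b c = [set p | exists x y z,
  [/\ 0 <= x, 0 <= y, 0 <= z, x + y + z = 1 & p = barycenter a b c x y z]].
Proof.
apply/seteqP; split.
  apply: smallest_sub.
    apply/convex_setE => _ _ t [x [y [z [x0 y0 z0 e ->]]]]
      [x' [y' [z' [x0' y0' z0' e' ->]]]] /andP[t0 t1].
    exists (t * x + (1 - t) * x'), (t * y + (1 - t) * y'),
      (t * z + (1 - t) * z').
    have t1' : 0 <= 1 - t by rewrite subr_ge0.
    split; rewrite ?addr_ge0 ?mulr_ge0//.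
      rewrite -[RHS](_ : t * (x + y + z) + (1 - t) * (x' + y' + z') = 1).
        by ring.
      by rewrite e e'; ring.
    by congr pair; rewrite /=; ring.
  move=> p /= [[->|->]|->].
  - by exists 1, 0, 0; split; rewrite ?ler01 ?addr0// [LHS]surjective_pairing;
      congr pair; ring.
  - by exists 0, 1, 0; split; rewrite ?ler01 ?addr0 ?add0r//
      [LHS]surjective_pairing; congr pair; ring.
  - by exists 0, 0, 1; split; rewrite ?ler01 ?addr0 ?add0r//
      [LHS]surjective_pairing; congr pair; ring.
move=> _ [x [y [z [x0 y0 z0 e ->]]]] S [/convex_setE cS abcS].
have [Sa Sb Sc] : [/\ S a, S b & S c].
  by split; apply: abcS; [left; left|left; right|right].
have [z1|z1] := eqVneq z 1.
  have -> : barycenter a b c x y z = c; last by [].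
  have [-> ->] : x = 0 /\ y = 0 by split; lra.
  by rewrite z1 [RHS]surjective_pairing; congr pair; ring.
have z1' : 0 < 1 - z by rewrite lt_def subr_eq0 eq_sym z1 /=; lra.
have Sab := cS a b (x / (1 - z)) Sa Sb.
have /Sab {}Sab : 0 <= x / (1 - z) <= 1.
  by rewrite divr_ge0 ?(ltW z1')//= ler_pdivrMr// mul1r; lra.
have := cS _ _ (1 - z) Sab Sc.
have -> : y = 1 - x - z by lra.
have -> : barycenter a b c x (1 - x - z) z =
  ((1 - z) * (x / (1 - z) * a.1 + (1 - x / (1 - z)) * b.1) +
    (1 - (1 - z)) * c.1,
   (1 - z) * (x / (1 - z) * a.2 + (1 - x / (1 - z)) * b.2) +
    (1 - (1 - z)) * c.2).
  by congr pair; field; rewrite gt_eqF.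
by apply; apply/andP; split; lra.
Qed.

Lemma triangle_vertices a b c :
  [/\ triangle a b c a, triangle a b c b & triangle a b c c].
Proof. by split=> S [_]; apply; [left; left|left; right|right]. Qed.

Lemma triangle_rot a b c : triangle a b c = triangle b c a.
Proof. by congr smallest; apply/seteqP; split=> p /=; tauto. Qed.

Lemma triangle_swap a b c : triangle a b c = triangle b a c.
Proof. by congr smallest; apply/seteqP; split=> p /=; tauto. Qed.

Lemma orient_rot a b c : orient a b c = orient b c a.
Proof. by rewrite /orient; ring. Qed.

Lemma orient_swap a b c : orient b a c = - orient a b c.
Proof. by rewrite /orient; ring. Qed.

(** The barycentric coordinates of [p] are its orientations with the three sides, divided by
    [orient a b c]. Multiplying instead of dividing gives sign conditions valid for either
    orientation of the triangle. *)
Lemma triangle_halfplanes a b c : orient a b c != 0 ->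
  triangle a b c = [set p | [/\ 0 <= orient a b c * orient a b p,
    0 <= orient a b c * orient b c p & 0 <= orient a b c * orient c a p]].
Proof.
move=> D0; rewrite triangleE; apply/seteqP; split => [p|p [ab bc ca]] /=.
  move=> [x [y [z [x0 y0 z0 /eqP]]]].
  rewrite -subr_eq0 => /eqP e ->.
  have ex : x = 1 - y - z by lra.
  split.
  - rewrite (_ : _ * _ = orient a b c ^+ 2 * z).
      exact: mulr_ge0 (sqr_ge0 _) _.
    by rewrite /orient /= ex; ring.
  - rewrite (_ : _ * _ = orient a b c ^+ 2 * x).
      exact: mulr_ge0 (sqr_ge0 _) _.
    by rewrite /orient /= ex; ring.
  - rewrite (_ : _ * _ = orient a b c ^+ 2 * y).
      exact: mulr_ge0 (sqr_ge0 _) _.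
    by rewrite /orient /= ex; ring.
have pos (u : R) : 0 <= orient a b c * u -> 0 <= u / orient a b c.
  move=> h; rewrite (_ : u / _ = orient a b c * u / orient a b c ^+ 2).
    by rewrite divr_ge0 ?sqr_ge0.
  by field.
exists (orient b c p / orient a b c), (orient c a p / orient a b c),
  (orient a b p / orient a b c); split; try exact: pos.
  rewrite -!mulrDl (_ : _ + _ + _ = orient a b c) ?divff//.
  by rewrite /orient; ring.
rewrite [LHS]surjective_pairing; move: D0; rewrite /orient => D0.
by congr pair; rewrite /=; field.
Qed.

Lemma noncollinear_orient a b c : orient a b c != 0 -> noncollinear a b c.
Proof.
move=> D0 s t [e1 e2].
have hs : orient a b c * s =
    (s * (b.1 - a.1) + t * (c.1 - a.1)) * (c.2 - a.2) -
    (s * (b.2 - a.2) + t * (c.2 - a.2)) * (c.1 - a.1).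
  by rewrite /orient; ring.
have ht : orient a b c * t =
    (s * (b.2 - a.2) + t * (c.2 - a.2)) * (b.1 - a.1) -
    (s * (b.1 - a.1) + t * (c.1 - a.1)) * (b.2 - a.2).
  by rewrite /orient; ring.
have f1 : s * (b.1 - a.1) + t * (c.1 - a.1) = 0 := e1.
have f2 : s * (b.2 - a.2) + t * (c.2 - a.2) = 0 := e2.
by split; apply/eqP; move: hs ht; rewrite f1 f2 !mul0r subr0 => /eqP + /eqP;
  rewrite !mulf_eq0 (negbTE D0).
Qed.

Lemma continuous_affine (u v w : R) :
  continuous (fun p : R * R => u * p.1 + v * p.2 + w).
Proof.
move=> p; apply: cvgD; last exact: cvg_cst.
by apply: cvgD; apply: cvgM; (try exact: cvg_cst);
  [exact: cvg_fst|exact: cvg_snd].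
Qed.

Lemma closed_halfplane (u v w : R) :
  closed [set p : R * R | 0 <= u * p.1 + v * p.2 + w].
Proof.
apply: (@closed_comp _ _ (fun p : R * R => u * p.1 + v * p.2 + w)
  [set x | 0 <= x]); last exact: closed_ge.
by move=> p _; exact: continuous_affine.
Qed.

Lemma closed_triangle a b c : orient a b c != 0 -> closed (triangle a b c).
Proof.
move=> D0; rewrite triangle_halfplanes//.
have cl (p q : R * R) : closed [set v | 0 <= orient a b c * orient p q v].
  rewrite (_ : mkset _ = [set v : R * R | 0 <=
    (- (orient a b c * (q.2 - p.2))) * v.1 +
    (orient a b c * (q.1 - p.1)) * v.2 +
    orient a b c * ((q.2 - p.2) * p.1 - (q.1 - p.1) * p.2)]).
    exact: closed_halfplane.
  by apply/seteqP; split => v /=; rewrite /orient => h;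
    (apply: le_trans h _; rewrite le_eqVlt; apply/orP; left; apply/eqP; ring).
rewrite (_ : mkset _ = [set v | 0 <= orient a b c * orient a b v] `&`
  [set v | 0 <= orient a b c * orient b c v] `&`
  [set v | 0 <= orient a b c * orient c a v]).
  by do 2 ?[apply: closedI]; apply: cl.
by apply/seteqP; split => [v []//|v [[]]].
Qed.

Lemma triangle_sub_halfplane a b c (u v w : R) :
  0 <= u * a.1 + v * a.2 + w -> 0 <= u * b.1 + v * b.2 + w ->
  0 <= u * c.1 + v * c.2 + w ->
  triangle a b c `<=` [set p | 0 <= u * p.1 + v * p.2 + w].
Proof.
move=> ha hb hc; rewrite triangleE => _ [x [y [z [x0 y0 z0 e ->]]]] /=.
rewrite (_ : _ + w = x * (u * a.1 + v * a.2 + w) + y * (u * b.1 + v * b.2 + w)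
  + z * (u * c.1 + v * c.2 + w)) ?addr_ge0 ?mulr_ge0//.
by rewrite (_ : x = 1 - y - z); [ring | lra].
Qed.

Lemma pair_neq0 (u v : R) : ((u, v) != 0) = (u != 0) || (v != 0).
Proof. by rewrite -[X in _ == X]/((0, 0) : R * R) xpair_eqE negb_and. Qed.

(** A common interior point would lie on the line itself, and a small step along the normal [(u, v)]
    would then leave the half-plane containing [T]. *)
Lemma separated_interior S T (u v w : R) : (u, v) != 0 ->
  S `<=` [set p | 0 <= u * p.1 + v * p.2 + w] ->
  T `<=` [set p | 0 <= (- u) * p.1 + (- v) * p.2 + (- w)] ->
  interior S `&` interior T = set0.
Proof.
move=> uv0 hS hT; apply/seteqP; split => // p [pS pT].
have : nbhs p (S `&` T) by exact: filterI.
move=> /nbhs_ballP[e /= e0 be].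
(* Dividing by [|u| + |v|] moves each coordinate by at most [e / 2], which fits the sup-norm
   ball. *)
pose q := (p.1 + e / 2 * (u / (`|u| + `|v|)),
  p.2 + e / 2 * (v / (`|u| + `|v|))).
have s0 : 0 < `|u| + `|v|.
  by rewrite lt_def addr_ge0// andbT paddr_eq0// !normr_eq0 negb_and -pair_neq0.
have le1 (x : R) : `|x| <= `|u| + `|v| -> `|e / 2 * (x / (`|u| + `|v|))| < e.
  move=> xs; rewrite !normrM !normfV (gtr0_norm e0) (gtr0_norm s0) normr_nat.
  have : `|x| / (`|u| + `|v|) <= 1 by rewrite ler_pdivrMr// mul1r.
  set r := _ / _ => r1; have : e / 2 * r <= e / 2 * 1.
    by rewrite ler_wpM2l// divr_ge0// ltW.
  by move: e0; lra.
have pp : u * p.1 + v * p.2 + w = 0.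
  have /= := hS _ (nbhs_singleton pS).
  have /= := hT _ (nbhs_singleton pT). lra.
have /be [_ /hT /=] : ball p e q.
  split; rewrite /ball /= opprD addrA subrr add0r normrN le1//.
    by rewrite lerDl.
  by rewrite lerDr.
have -> : - u * q.1 + - v * q.2 + - w =
    - (u * p.1 + v * p.2 + w) - (e / 2 / (`|u| + `|v|)) * (u ^+ 2 + v ^+ 2).
  by rewrite /q/=; ring.
rewrite pp oppr0 add0r oppr_ge0 leNgt => /negP; apply.
rewrite mulr_gt0 ?divr_gt0// lt_def addr_ge0 ?sqr_ge0// andbT.
by rewrite paddr_eq0 ?sqr_ge0// !expf_eq0/= negb_and -pair_neq0.
Qed.

End Triangles.

(** * Area of a triangle *)

Section TriangleArea.
Variable R : realType.
Implicit Types (a b c p : R * R).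

Local Notation mu := (@lebesgue_measure R).

Lemma measurable_affine (D : set R) (u v : R) :
  measurable_fun D (EFin \o (fun h : R => u * h + v)).
Proof. by apply/measurable_EFinP/measurable_funD. Qed.

Lemma integral_affine (b0 b1 : bool) (u v x y : R) : x <= y ->
  (\int[mu]_(h in [set` Interval (BSide b0 x) (BSide b1 y)]) (u * h + v)%:E =
    (u * (y ^+ 2 - x ^+ 2) / 2 + v * (y - x))%:E)%E.
Proof.
rewrite integral_itv_bndoo; last exact: measurable_affine.
rewrite -(@integral_itv_bndoo _ _ _ _ true false);
  last exact: measurable_affine.
rewrite le_eqVlt => /predU1P[->|xy].
  by rewrite set_itv1 integral_set1 !subrr !mulr0 mul0r addr0.
pose F := (u / 2) *: 'X^2 + v *: 'X : {poly R}.
rewrite (@continuous_FTC2 _ _ (horner F))//.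
- rewrite -EFinB; congr EFin.
  by rewrite /F !(hornerD, hornerZ, hornerXn, hornerX); field.
- apply: continuous_subspaceT => h; apply: cvgD; last exact: cvg_cst.
  by apply: cvgM; [exact: cvg_cst|exact: cvg_id].
- split; first by move=> h _; exact: derivable_horner.
    exact/cvg_at_right_filter/continuous_horner.
  exact/cvg_at_left_filter/continuous_horner.
- move=> h _; rewrite derive1E derive_val /=.
  rewrite /F derivD !derivZ derivXn derivX hornerD !hornerZ hornerMn.
  by rewrite hornerXn hornerC; field.
Qed.

(** The sign of [s] decides which endpoint is the upper one, so sections of triangles of both
    orientations are covered at once. *)
Lemma measure_segment (s x y : R) : s != 0 -> 0 <= s * (y - x) ->
  mu [set z | 0 <= s * (z - x) /\ 0 <= s * (y - z)] = `|y - x|%:E.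
Proof.
move=> s0; have [sp|sn|/eqP] := ltgtP 0 s; last by rewrite eq_sym (negbTE s0).
  rewrite pmulr_rge0// subr_ge0 => xy.
  rewrite (_ : mkset _ = [set` `[x, y]]).
    rewrite lebesgue_measure_itv/= lte_fin ger0_norm ?subr_ge0//.
    by case: ltgtP xy => // ->; rewrite subrr.
  apply/seteqP; split => z /=; rewrite in_itv/= !pmulr_rge0// !subr_ge0.
    by move=> [-> ->].
  by move=> /andP[].
rewrite nmulr_rge0// subr_le0 => xy.
rewrite (_ : mkset _ = [set` `[y, x]]).
  rewrite lebesgue_measure_itv/= lte_fin ler0_norm ?subr_le0// opprB.
  by case: ltgtP xy => // ->; rewrite subrr.
apply/seteqP; split => z /=; rewrite in_itv/= !nmulr_rge0// !subr_le0.
  by move=> [-> ->].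
by move=> /andP[].
Qed.

(** Such an [f] is the section length of a triangle. Its value at the peak [y] is left free: a
    vertical side gives [x = y] or [y = z], and the formula with denominator 0 would be wrong
    there. *)
Lemma integral_tent (f : R -> \bar R) (W x y z : R) :
  x <= y -> y <= z -> x < z ->
  (forall h, x <= h < y -> f h = (W * (h - x) / (y - x))%:E) ->
  (forall h, y < h <= z -> f h = (W * (z - h) / (z - y))%:E) ->
  (forall h, h < x \/ z < h -> f h = 0%E) ->
  (\int[mu]_h f h = (W * (z - x) / 2)%:E)%E.
Proof.
move=> xy yz xz f1 f2 f0.
have f1' h : h \in `[x, y[%classic ->
    f h = (W / (y - x) * h + - (W / (y - x) * x))%:E.
  by rewrite inE/= in_itv/= => /f1 ->; congr EFin; ring.
have f2' h : h \in `]y, z]%classic ->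
    f h = (- (W / (z - y)) * h + W / (z - y) * z)%:E.
  by rewrite inE/= in_itv/= => /f2 ->; congr EFin; ring.
have m1 : measurable_fun `[x, y[ f.
  apply: (@eq_measurable_fun _ _ _ _ _ (EFin \o
    (fun h => W / (y - x) * h + - (W / (y - x) * x)))).
    by move=> h /f1' ->.
  exact: measurable_affine.
have m2 : measurable_fun `]y, z] f.
  apply: (@eq_measurable_fun _ _ _ _ _ (EFin \o
    (fun h => - (W / (z - y)) * h + W / (z - y) * z))).
    by move=> h /f2' ->.
  exact: measurable_affine.
have m2' : measurable_fun `[y, z] f.
  by apply/emeasurable_fun_itv_obnd_cbndP.
have fE : f = f \_ (`[x, y[ `|` `[y, z]).
  apply/funext => h; rewrite patchE; case: ifPn => // /negP; rewrite inE/=.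
  rewrite !in_itv/= => hn; apply: f0.
  have [hx|xh] := ltP h x; first by left.
  have [zh|hz] := ltP z h; first by right.
  case: hn; have [hy|yh] := ltP h y; [left|right]; exact/andP.
rewrite fE -integral_mkcond integral_setU//; first last.
- rewrite disj_set2E; apply/eqP/seteqP; split => // h [] /=.
  by rewrite !in_itv/= => /andP[_ hy] /andP[]; rewrite leNgt hy.
- exact/measurable_funU.
rewrite -(@integral_itv_obnd_cbnd _ y)//.
under eq_integral do rewrite f1'//.
under [X in (_ + X)%E]eq_integral do rewrite f2'//.
rewrite !integral_affine// -EFinD; congr EFin.
(* In the degenerate cases the inverse of 0 is 0, so the empty half contributes nothing. *)
have [xy'|xy'] := eqVneq x y; have [yz'|yz'] := eqVneq y z.
- by move: xz; rewrite xy' yz' ltxx.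
- by rewrite xy' subrr invr0; field; rewrite subr_eq0 eq_sym.
- by rewrite yz' subrr invr0; field; rewrite -yz' subr_eq0 eq_sym.
- by field; apply/andP; split; rewrite subr_eq0 eq_sym.
Qed.

(** The product measure integrates the lengths of the vertical sections, which form a tent with peak
    [|orient a b c| / (c.1 - a.1)] over [b.1]. *)
Lemma area_sorted a b c : orient a b c != 0 ->
  a.1 <= b.1 -> b.1 <= c.1 ->
  area (triangle a b c) = (`|orient a b c| / 2)%:E.
Proof.
move=> D0 ab bc; set D := orient a b c.
have DD : 0 < D * D by rewrite -expr2 exprn_even_gt0.
have ac : a.1 < c.1.
  rewrite lt_def (le_trans ab bc) andbT; apply: contraNneq D0 => ca.
  have ba : b.1 = a.1 by lra.
  by rewrite /orient ca ba; apply/eqP; ring.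
rewrite /area /product_measure1.
rewrite (@integral_tent _ (`|D| / (c.1 - a.1)) a.1 b.1 c.1)//.
- by congr EFin; field; rewrite subr_eq0 gt_eqF.
- move=> h /andP[ah hb] /=.
  have ab' : 0 < b.1 - a.1 by rewrite subr_gt0 (le_lt_trans ah).
  have ac' : 0 < c.1 - a.1 by rewrite subr_gt0.
  (* To the left of [b] the section is cut out by the sides [ab] and [ac], met over [h] at the
     heights [x1] and [x2]. *)
  pose x1 := a.2 + (b.2 - a.2) * (h - a.1) / (b.1 - a.1).
  pose x2 := a.2 + (c.2 - a.2) * (h - a.1) / (c.1 - a.1).
  have e21 : x2 - x1 = D * ((h - a.1) / ((b.1 - a.1) * (c.1 - a.1))).
    by rewrite /x1 /x2 /D /orient; field; rewrite !gt_eqF.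
  have p0 : 0 <= (h - a.1) / ((b.1 - a.1) * (c.1 - a.1)).
    by rewrite divr_ge0 ?subr_ge0// ltW// mulr_gt0.
  rewrite (_ : xsection _ _ =
      [set x | 0 <= D * (x - x1) /\ 0 <= D * (x2 - x)]).
    rewrite measure_segment//; last by rewrite e21 mulrA mulr_ge0// ltW.
    rewrite e21 normrM (ger0_norm p0); congr EFin; field.
    by rewrite !gt_eqF.
  apply/seteqP; split => x; rewrite /xsection/= inE triangle_halfplanes//=.
    move=> [oab _ oca]; split.
      rewrite -(pmulr_rge0 _ ab')
        [X in 0 <= X](_ : _ = D * orient a b (h, x))//.
      by rewrite /x1 /orient/=; field; rewrite gt_eqF.
    rewrite -(pmulr_rge0 _ ac') [X in 0 <= X](_ : _ = D * orient c a (h, x))//.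
    by rewrite /x2 /orient/=; field; rewrite gt_eqF.
  move=> [h1 h2].
  have oab : 0 <= D * orient a b (h, x).
    rewrite [X in 0 <= X](_ : _ = (b.1 - a.1) * (D * (x - x1)));
      first exact: mulr_ge0 (ltW ab') h1.
    by rewrite /x1 /orient/=; field; rewrite gt_eqF.
  split=> //.
    rewrite -(pmulr_rge0 _ ab') [X in 0 <= X](_ : _ =
      D * D * (b.1 - h) + D * orient a b (h, x) * (c.1 - b.1)).
      by apply: addr_ge0; apply: mulr_ge0; rewrite // ?subr_ge0// ltW.
    by rewrite /D /orient/=; ring.
  rewrite [X in 0 <= X](_ : _ = (c.1 - a.1) * (D * (x2 - x)));
    first exact: mulr_ge0 (ltW ac') h2.
  by rewrite /x2 /D /orient/=; field; rewrite gt_eqF.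
- move=> h /andP[bh hc] /=.
  have bc' : 0 < c.1 - b.1 by rewrite subr_gt0 (lt_le_trans bh).
  have ac' : 0 < c.1 - a.1 by rewrite subr_gt0.
  pose x1 := c.2 + (b.2 - c.2) * (c.1 - h) / (c.1 - b.1).
  pose x2 := c.2 + (a.2 - c.2) * (c.1 - h) / (c.1 - a.1).
  have e21 : x2 - x1 = D * ((c.1 - h) / ((c.1 - b.1) * (c.1 - a.1))).
    by rewrite /x1 /x2 /D /orient; field; rewrite !gt_eqF.
  have p0 : 0 <= (c.1 - h) / ((c.1 - b.1) * (c.1 - a.1)).
    by rewrite divr_ge0 ?subr_ge0// ltW// mulr_gt0.
  rewrite (_ : xsection _ _ =
      [set x | 0 <= D * (x - x1) /\ 0 <= D * (x2 - x)]).
    rewrite measure_segment//; last by rewrite e21 mulrA mulr_ge0// ltW.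
    rewrite e21 normrM (ger0_norm p0); congr EFin; field.
    by rewrite !gt_eqF.
  apply/seteqP; split => x; rewrite /xsection/= inE triangle_halfplanes//=.
    move=> [_ obc oca]; split.
      rewrite -(pmulr_rge0 _ bc')
        [X in 0 <= X](_ : _ = D * orient b c (h, x))//.
      by rewrite /x1 /orient/=; field; rewrite gt_eqF.
    rewrite -(pmulr_rge0 _ ac') [X in 0 <= X](_ : _ = D * orient c a (h, x))//.
    by rewrite /x2 /orient/=; field; rewrite gt_eqF.
  move=> [h1 h2].
  have obc : 0 <= D * orient b c (h, x).
    rewrite [X in 0 <= X](_ : _ = (c.1 - b.1) * (D * (x - x1)));
      first exact: mulr_ge0 (ltW bc') h1.
    by rewrite /x1 /orient/=; field; rewrite gt_eqF.
  split=> //.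
    rewrite -(pmulr_rge0 _ bc') [X in 0 <= X](_ : _ =
      D * D * (h - b.1) + D * orient b c (h, x) * (b.1 - a.1)).
      by apply: addr_ge0; apply: mulr_ge0; rewrite // ?subr_ge0// ltW.
    by rewrite /D /orient/=; ring.
  rewrite [X in 0 <= X](_ : _ = (c.1 - a.1) * (D * (x2 - x)));
    first exact: mulr_ge0 (ltW ac') h2.
  by rewrite /x2 /D /orient/=; field; rewrite gt_eqF.
- move=> h hac /=; rewrite (_ : xsection _ _ = set0) ?measure0//.
  apply/seteqP; split => // x; rewrite /xsection/= inE triangle_halfplanes//=.
  rewrite -/D => -[oab obc oca].
  have e1 : 0 <= D * D * (h - a.1).
    rewrite [X in 0 <= X](_ : _ = (b.1 - a.1) * (D * orient c a (h, x)) +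
      (c.1 - a.1) * (D * orient a b (h, x))).
      by apply: addr_ge0; apply: mulr_ge0; rewrite // subr_ge0// ltW.
    by rewrite /D /orient/=; ring.
  have e2 : 0 <= D * D * (c.1 - h).
    rewrite [X in 0 <= X](_ : _ = (c.1 - a.1) * (D * orient b c (h, x)) +
      (c.1 - b.1) * (D * orient c a (h, x))).
      by apply: addr_ge0; apply: mulr_ge0; rewrite // subr_ge0// ltW.
    by rewrite /D /orient/=; ring.
  move: e1 e2; rewrite !pmulr_rge0// !subr_ge0 => e1 e2.
  by case: hac; rewrite ltNge ?e1 ?e2.
Qed.

Lemma area_triangle a b c : orient a b c != 0 ->
  area (triangle a b c) = (`|orient a b c| / 2)%:E.
Proof.
pose P a b c := orient a b c != 0 ->
  area (triangle a b c) = (`|orient a b c| / 2)%:E.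
have rot u v w : P u v w -> P v w u.
  by rewrite /P (orient_rot u) (triangle_rot u).
have swap u v w : P u v w -> P v u w.
  by rewrite /P (orient_swap u) oppr_eq0 normrN (triangle_swap u).
have sorted u v w : u.1 <= v.1 -> v.1 <= w.1 -> P u v w.
  by move=> uv vw uvw; exact: area_sorted.
have [ab|/ltW ba] := leP a.1 b.1; have [bc|/ltW cb] := leP b.1 c.1;
  have [ac|/ltW ca] := leP a.1 c.1.
- exact: sorted.
- exact: sorted.
- exact/rot/swap/sorted.
- exact/rot/sorted.
- exact/swap/sorted.
- exact/rot/rot/sorted.
- exact/rot/rot/swap/sorted.
- exact/rot/rot/swap/sorted.
Qed.

End TriangleArea.

(** * Congruent triangles *)

Section Congruence.
Variable R : realType.
Implicit Types (a b c p q u v : R * R) (S T : set (R * R)).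

Definition sum_sq_sides a b c : R :=
  eucl_dist a b ^+ 2 + eucl_dist b c ^+ 2 + eucl_dist c a ^+ 2.

(* Extreme points, expressed through distances only so that the notion is
   visibly invariant under isometries. *)
Definition extreme S v : Prop := S v /\ forall p q, S p -> S q ->
  eucl_dist v p = eucl_dist p q / 2 -> eucl_dist v q = eucl_dist p q / 2 ->
  p = q.

Lemma eucl_dist_sq p q :
  eucl_dist p q ^+ 2 = (p.1 - q.1) ^+ 2 + (p.2 - q.2) ^+ 2.
Proof. by rewrite /eucl_dist sqr_sqrtr// addr_ge0// sqr_ge0. Qed.

Lemma eucl_dist_sym p q : eucl_dist p q = eucl_dist q p.
Proof. by congr Num.sqrt; ring. Qed.

Lemma eucl_dist_eq0 p q : eucl_dist p q = 0 -> p = q.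
Proof.
move=> /(congr1 (fun x => x ^+ 2)); rewrite eucl_dist_sq expr0n/= => /eqP.
rewrite paddr_eq0 ?sqr_ge0// !expf_eq0/= !subr_eq0 => /andP[/eqP e1 /eqP e2].
by rewrite [p]surjective_pairing e1 e2 -surjective_pairing.
Qed.

(** By the parallelogram law, [|p + q - 2v|^2 = 2|p - v|^2 + 2|q - v|^2 - |p - q|^2], and the right
    side is 0 here. *)
Lemma eucl_dist_midpoint v p q :
  eucl_dist v p = eucl_dist p q / 2 -> eucl_dist v q = eucl_dist p q / 2 ->
  p.1 + q.1 = 2 * v.1 /\ p.2 + q.2 = 2 * v.2.
Proof.
move=> /(congr1 (fun x => x ^+ 2)) + /(congr1 (fun x => x ^+ 2)).
rewrite !exprMn !eucl_dist_sq => e1 e2.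
have : (p.1 + q.1 - 2 * v.1) ^+ 2 + (p.2 + q.2 - 2 * v.2) ^+ 2 = 0 by lra.
move=> /eqP; rewrite paddr_eq0 ?sqr_ge0// !expf_eq0/= !subr_eq0.
by move=> /andP[/eqP -> /eqP ->].
Qed.

Lemma extreme_isometry (f : R * R -> R * R) S v : plane_isometry f ->
  extreme S v -> extreme (f @` S) (f v).
Proof.
move=> isof [Sv ev]; split; first by exists v.
by move=> _ _ [p Sp <-] [q Sq <-]; rewrite !isof => ? ?; congr f; exact: ev.
Qed.

(** Orientations with the two sides through [a] are affine, vanish at [a] and keep one sign on the
    triangle. If [a] is the midpoint of [p] and [q], they vanish at both, which forces
    [p = a = q]. *)
Lemma extreme_vertex a b c : orient a b c != 0 -> extreme (triangle a b c) a.
Proof.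
move=> D0; split; first by have [] := triangle_vertices a b c.
move=> p q; rewrite triangle_halfplanes// => -[p1 _ p2] [q1 _ q2] ep eq.
have [m1 m2] := eucl_dist_midpoint ep eq.
have e1 : orient a b c * orient a b p + orient a b c * orient a b q = 0.
  have -> : q = (2 * a.1 - p.1, 2 * a.2 - p.2).
    by rewrite [q]surjective_pairing -m1 -m2; congr pair; ring.
  by rewrite /orient/=; ring.
have e2 : orient a b c * orient c a p + orient a b c * orient c a q = 0.
  have -> : q = (2 * a.1 - p.1, 2 * a.2 - p.2).
    by rewrite [q]surjective_pairing -m1 -m2; congr pair; ring.
  by rewrite /orient/=; ring.
have {p1 q1 e1} : orient a b c * orient a b p == 0 by apply/eqP; lra.
have {p2 q2 e2} : orient a b c * orient c a p == 0 by apply/eqP; lra.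
rewrite !mulf_eq0 (negbTE D0)/= => /eqP ca /eqP ab.
have h1 : orient a b c * (p.1 - a.1) =
    (b.1 - a.1) * orient c a p + (c.1 - a.1) * orient a b p.
  by rewrite /orient; ring.
have h2 : orient a b c * (p.2 - a.2) =
    (b.2 - a.2) * orient c a p + (c.2 - a.2) * orient a b p.
  by rewrite /orient; ring.
move: h1 h2; rewrite ca ab !mulr0 addr0 => /eqP + /eqP.
rewrite !mulf_eq0 (negbTE D0)/= => /eqP h1 /eqP h2.
by rewrite [p]surjective_pairing [q]surjective_pairing; congr pair; lra.
Qed.

(** Shifting the weight [min x y] from [b] to [a], or from [a] to [b], gives the two ends of a
    nondegenerate segment in the triangle whose midpoint is the given point. *)
Lemma extreme_barycenter a b c (x y z : R) : a <> b ->
  0 < x -> 0 < y -> 0 <= z -> x + y + z = 1 ->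
  ~ extreme (triangle a b c) (barycenter a b c x y z).
Proof.
move=> ab x0 y0 z0 e1 [_ /(_
  (barycenter a b c (x + Num.min x y) (y - Num.min x y) z)
  (barycenter a b c (x - Num.min x y) (y + Num.min x y) z))].
set e := Num.min x y.
have e0 : 0 < e by rewrite lt_min x0.
have ex : e <= x by rewrite ge_min lexx.
have ey : e <= y by rewrite ge_min lexx orbT.
have dE (s t s' t' d : R) : 0 <= d -> t - t' = - (s - s') ->
    (s - s') ^+ 2 = d ^+ 2 ->
  eucl_dist (barycenter a b c s t z) (barycenter a b c s' t' z) =
    d * eucl_dist a b.
  move=> d0 tE sE; rewrite /eucl_dist -[d in RHS](ger0_norm d0) -sqrtr_sqr.
  rewrite -sqrtrM ?sqr_ge0// -sE (_ : t' = t + (s - s')); last by lra.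
  by congr Num.sqrt; rewrite /=; ring.
rewrite (dE (x + e) _ _ _ (2 * e)) ?(dE x _ _ _ e) ?mulr_ge0 ?(ltW e0)//;
  try by ring.
move=> mid; have [] : barycenter a b c (x + e) (y - e) z =
    barycenter a b c (x - e) (y + e) z; [apply: mid|].
- rewrite triangleE; exists (x + e), (y - e), z; split=> //; lra.
- rewrite triangleE; exists (x - e), (y + e), z; split=> //; lra.
- by field.
- by field.
- move=> [e2 e3]; apply: ab.
  rewrite [a]surjective_pairing [b]surjective_pairing.
  have h1 : 2 * e * (a.1 - b.1) = 0 by lra.
  have h2 : 2 * e * (a.2 - b.2) = 0 by lra.
  move: h1 h2 => /eqP + /eqP; rewrite !mulf_eq0 pnatr_eq0 (gt_eqF e0)/=.
  by rewrite !subr_eq0 => /eqP -> /eqP ->.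
Qed.

Lemma orient_neq a b c : orient a b c != 0 -> a <> b.
Proof. by move=> + ab; rewrite ab /orient !subrr !mul0r subrr eqxx. Qed.

Lemma extremeP a b c p : orient a b c != 0 ->
  extreme (triangle a b c) p -> [\/ p = a, p = b | p = c].
Proof.
move=> D0 ep; move: (ep) => [+ _].
have ab := orient_neq D0.
have bc : b <> c by apply: (@orient_neq _ _ a); rewrite -orient_rot.
have ca : c <> a by apply: (@orient_neq _ _ b); rewrite -2!orient_rot.
rewrite triangleE => -[x [y [z [x0 y0 z0 e pE]]]]; rewrite pE in ep *.
have [xz|xp] := eqVneq x 0.
  have [yz|yp] := eqVneq y 0.
    apply: Or33; have -> : z = 1 by lra.
    by rewrite xz yz [RHS]surjective_pairing; congr pair; ring.
  have [zz|zp] := eqVneq z 0.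
    apply: Or32; have -> : y = 1 by lra.
    by rewrite xz zz [RHS]surjective_pairing; congr pair; ring.
  exfalso; move: ep; rewrite triangle_rot.
  rewrite (_ : barycenter a b c x y z = barycenter b c a y z x).
    by apply: extreme_barycenter => //; rewrite ?lt_def ?yp ?zp//; lra.
  by congr pair; ring.
have [yz|yp] := eqVneq y 0.
  have [zz|zp] := eqVneq z 0.
    apply: Or31; have -> : x = 1 by lra.
    by rewrite yz zz [RHS]surjective_pairing; congr pair; ring.
  exfalso; move: ep; rewrite -triangle_rot.
  rewrite (_ : barycenter a b c x y z = barycenter c a b z x y).
    by apply: extreme_barycenter => //; rewrite ?lt_def ?xp ?zp//; lra.
  by congr pair; ring.
by exfalso; move: ep; apply: extreme_barycenter => //; rewrite lt_def ?xp ?yp.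
Qed.

(** An isometry carries extreme points to extreme points, hence vertices to vertices, and is
    injective; so it only permutes the side lengths. *)
Lemma congruent_sum_sq_sides a b c a' b' c' :
  orient a b c != 0 -> orient a' b' c' != 0 ->
  plane_congruent (triangle a b c) (triangle a' b' c') ->
  sum_sq_sides a b c = sum_sq_sides a' b' c'.
Proof.
move=> D0 D0' [f isof fE].
have inj p q : p <> q -> f p <> f q.
  move=> pq fpq; apply: pq; apply: eucl_dist_eq0; rewrite -isof fpq.
  by rewrite /eucl_dist !subrr expr0n/= addr0 sqrtr0.
have vert p : extreme (triangle a b c) p ->
    [\/ f p = a', f p = b' | f p = c'].
  by move=> /(extreme_isometry isof); rewrite fE; exact: extremeP.
have Db : orient b c a != 0 by rewrite -orient_rot.
have Dc : orient c a b != 0 by rewrite -orient_rot.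
have Ta := vert _ (extreme_vertex D0).
have Tb : [\/ f b = a', f b = b' | f b = c'].
  by apply: vert; rewrite triangle_rot; exact: extreme_vertex.
have Tc : [\/ f c = a', f c = b' | f c = c'].
  by apply: vert; rewrite -triangle_rot; exact: extreme_vertex.
have := inj _ _ (orient_neq D0); have := inj _ _ (orient_neq Db).
have := inj _ _ (orient_neq Dc).
rewrite /sum_sq_sides -(isof a) -(isof b) -(isof c).
by case: Ta => ->; case: Tb => ->; case: Tc => -> //= _ _ _;
  rewrite ?(eucl_dist_sym b' a') ?(eucl_dist_sym c' b') ?(eucl_dist_sym a' c');
  ring.
Qed.

End Congruence.

(** * Triangular and trapezoidal cells *)

Section Cells.
Variable R : realType.
Implicit Types (p v : R * R) (h x q s : R).

Definition sqrt5 : R := Num.sqrt 5.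

Lemma sqrt5_sq : sqrt5 * sqrt5 = 5.
Proof. by rewrite -expr2 sqr_sqrtr. Qed.

Lemma sqrt5_bounds : 11 / 5 < sqrt5 < 9 / 4.
Proof.
have w0 : 0 <= sqrt5 by exact: sqrtr_ge0.
have w2 := sqrt5_sq.
by apply/andP; split; nra.
Qed.

(** The other parallel side is longer by [sqrt5]. The two sum to 5, so a trapezoid of width 2 has
    area 5, and their difference is irrational. *)
Definition short_base : R := (5 - sqrt5) / 2.

(* The value of the height of the apex is forced by the areas: with
   [short_base * y = 2] and [(short_base + sqrt5) * (2 - y) = 2] the bottom and
   top triangles of the fan have area 1, which leaves area 3 for the side. *)
Definition fan_apex : R * R := (1 + sqrt5 / 5, 0).

(** The boundary of the trapezoid, clockwise from the lower left corner. The upper edge is divided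
    into thirds, which cuts the middle triangle of area 3 into three of area 1. *)
Definition fan_point (j : nat) : R * R :=
  match j with
  | 0 => (0, 0)
  | 1 => (0, short_base)
  | 2 => (2 / 3, short_base + sqrt5 / 3)
  | 3 => (4 / 3, short_base + sqrt5 * 2 / 3)
  | 4 => (2, short_base + sqrt5)
  | _ => (2, 0)
  end.

Definition cell_width (triangular : bool) h : R :=
  if triangular then 1 - h / 2 else short_base + sqrt5 / 2 * h.

(* Piece [0] is a whole triangular cell, pieces [1] to [5] are the five
   triangles of the fan that dissects a trapezoidal cell. *)
Definition vertex (j l : nat) : R * R :=
  match j, l with
  | 0, 0 => (0, 0)
  | 0, 1 => (2, 0)
  | 0, _ => (0, 1)
  | _.+1, 0 => fan_apex
  | j'.+1, 1 => fan_point j'.+1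
  | j'.+1, _ => fan_point j'
  end.

(** Here [sqrt5] becomes an unknown known only through its square and its rational bounds; this
    suffices for every fact about the cells. *)
Ltac numeric :=
  rewrite /orient /cell_width /vertex /fan_point /fan_apex /short_base /=;
  have := sqrt5_sq; have /andP := sqrt5_bounds; case;
  generalize sqrt5 => w; intros; (lra || nra).

Lemma orient_vertex j : (j < 6)%N ->
  orient (vertex j 0) (vertex j 1) (vertex j 2) = 2.
Proof. by case: j => [|[|[|[|[|[|//]]]]]] _; numeric. Qed.

Lemma vertex_cell j l : (j < 6)%N ->
  [/\ 0 <= (vertex j l).1, (vertex j l).1 <= 2, 0 <= (vertex j l).2 &
      (vertex j l).2 <= cell_width (j == 0%N) (vertex j l).1].
Proof.
by case: j l => [|[|[|[|[|[|//]]]]]] [|[|l]] _; split; numeric.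
Qed.

Lemma cell_width_ge0 e h : 0 <= h <= 2 -> 0 <= cell_width e h.
Proof. by move=> /andP[h0 h2]; case: e; numeric. Qed.

Lemma cell_width_le4 e h : 0 <= h <= 2 -> cell_width e h <= 4.
Proof. by move=> /andP[h0 h2]; case: e; numeric. Qed.

(** The pieces of the fan are ordered by angle around the apex, so the last ray of a piece separates
    it from all later pieces. *)
Lemma fan_separation j j' l : (j < j')%N -> (j' < 5)%N ->
  0 <= orient fan_apex (fan_point j.+1) (vertex j.+1 l) /\
  orient fan_apex (fan_point j.+1) (vertex j'.+1 l) <= 0.
Proof.
by case: j j' l => [|[|[|[|j]]]] [|[|[|[|[|j']]]]] [|[|l]] //= _ _;
  split; numeric.
Qed.

Lemma fan_apex_neq j : (fan_point j).1 - fan_apex.1 != 0.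
Proof.
by case: j => [|[|[|[|[|j]]]]]; apply/eqP; numeric.
Qed.

Lemma cell_cover e p : 0 <= p.1 <= 2 -> 0 <= p.2 <= cell_width e p.1 ->
  exists j, [/\ (j < 6)%N, (j == 0%N) = e &
    triangle (vertex j 0) (vertex j 1) (vertex j 2) p].
Proof.
have w2 := sqrt5_sq; have /andP[w0 w1] := sqrt5_bounds.
move=> /andP[h0 h2] /andP[x0 x1]; case: e x1 => x1.
  exists 0%N; split=> //.
  rewrite triangle_halfplanes orient_vertex ?pnatr_eq0//=.
  by rewrite !pmulr_rge0//; split; move: x1; numeric.
(* The point is not beyond the ray to [fan_point j.+1] in clockwise order. The first such ray closes
   the piece containing the point, since minimality puts the point beyond the preceding ray. *)
pose inside j := 0 <= orient fan_apex (fan_point j.+1) p.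
have o0 : orient fan_apex (fan_point 0) p <= 0.
  by numeric.
have o5 : inside 4%N by rewrite /inside; numeric.
have outer j : (j < 5)%N -> 0 <= orient (fan_point j.+1) (fan_point j) p.
  case: j => [|[|[|[|[|//]]]]] _; move: x1; numeric.
have : exists j, inside j by exists 4%N.
move=> /ex_minnP[j ij jmin]; exists j.+1.
have j5 : (j < 5)%N by rewrite ltnS; exact: jmin.
split=> //.
rewrite triangle_halfplanes orient_vertex ?pnatr_eq0//= !pmulr_rge0//.
split=> //; first exact: outer.
rewrite (_ : orient _ _ _ = - orient fan_apex (fan_point j) p); last first.
  by rewrite /orient; ring.
rewrite oppr_ge0; case: j ij jmin j5 => [//|j] _ jmin _.
by rewrite leNgt; apply/negP => /ltW /jmin; rewrite ltnn.
Qed.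

(** * Shears and their effect on the sides *)

Definition shear (h q s : R) p : R * R := (p.1 + h, p.2 + q + s * p.1).

Lemma orient_shear h q s p v p' :
  orient (shear h q s p) (shear h q s v) (shear h q s p') = orient p v p'.
Proof. by rewrite /orient /shear /=; ring. Qed.

Lemma triangle_shear h q s a b c p : orient a b c != 0 ->
  triangle a b c p ->
  triangle (shear h q s a) (shear h q s b) (shear h q s c) (shear h q s p).
Proof.
by move=> D0; rewrite !triangle_halfplanes ?orient_shear//= !orient_shear.
Qed.

(* Under a shear of factor [s] an edge vector [(y, x)] becomes [(y, x + s * y)];
   its squared length has the coefficients [y ^+ 2], [2 * y * x] and
   [y ^+ 2 + x ^+ 2] in [s]. *)
Definition sq_coef (c : R -> R -> R) (j : nat) : R :=
  c ((vertex j 0).1 - (vertex j 1).1) ((vertex j 0).2 - (vertex j 1).2) +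
  c ((vertex j 1).1 - (vertex j 2).1) ((vertex j 1).2 - (vertex j 2).2) +
  c ((vertex j 2).1 - (vertex j 0).1) ((vertex j 2).2 - (vertex j 0).2).

Definition sq_coef2 := sq_coef (fun y _ => y ^+ 2).
Definition sq_coef1 := sq_coef (fun y x => 2 * y * x).
Definition sq_coef0 := sq_coef (fun y x => y ^+ 2 + x ^+ 2).

Lemma sum_sq_sides_shear h q s j :
  sum_sq_sides (shear h q s (vertex j 0)) (shear h q s (vertex j 1))
    (shear h q s (vertex j 2)) =
  sq_coef2 j * s ^+ 2 + sq_coef1 j * s + sq_coef0 j.
Proof.
rewrite /sum_sq_sides !eucl_dist_sq /sq_coef2 /sq_coef1 /sq_coef0 /sq_coef.
by rewrite /shear/=; ring.
Qed.

(** The values are roughly 8, 4.19, 3.15, 1.07, 0.76 and 0.61. The smallest ratio, about 1.248 for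
    the last two, leaves room for [121 / 100], the bound on squared strip factors. *)
Lemma sq_coef2_gap j j' : (j < j')%N -> (j' < 6)%N ->
  0 < sq_coef2 j' /\ 121 / 100 * sq_coef2 j' < sq_coef2 j.
Proof.
rewrite /sq_coef2 /sq_coef.
by case: j j' => [|[|[|[|[|j]]]]] [|[|[|[|[|[|j']]]]]] //= _ _; split; numeric.
Qed.

Lemma eucl_dist_shear_le h q s p v : 0 <= p.1 <= 2 -> 0 <= v.1 <= 2 ->
  0 <= p.2 <= 4 -> 0 <= v.2 <= 4 ->
  eucl_dist (shear h q s p) (shear h q s v) <= 6 + 2 * `|s|.
Proof.
move=> p1 v1 p2 v2.
rewrite /eucl_dist -[leRHS]ger0_norm; last first.
  by rewrite addr_ge0 ?mulr_ge0.
rewrite -sqrtr_sqr ler_sqrt; last exact: sqr_ge0.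
have dx : `|p.1 - v.1| <= 2 by rewrite ler_norml; lra.
have dy : `|p.2 - v.2| <= 4 by rewrite ler_norml; lra.
have -> : (shear h q s p).1 - (shear h q s v).1 = p.1 - v.1.
  by rewrite /shear/=; ring.
have -> : (shear h q s p).2 - (shear h q s v).2 =
    p.2 - v.2 + s * (p.1 - v.1) by rewrite /shear/=; ring.
have le2 : `|p.2 - v.2 + s * (p.1 - v.1)| <= 4 + 2 * `|s|.
  rewrite (le_trans (ler_normD _ _))// lerD// normrM mulrC ler_wpM2r//.
rewrite -(real_normK (num_real (p.1 - v.1))).
rewrite -(real_normK (num_real (_ + s * _))).
have s0 := normr_ge0 s.
move: dx le2 (normr_ge0 (p.1 - v.1)) (normr_ge0 (p.2 - v.2 + s * (p.1 - v.1))).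
move: `|_| `|_| `|s| s0 => d e t t0 *; nra.
Qed.

End Cells.

(** * Generic shears *)

Section Generic.
Variable R : realType.

Lemma countable_quadratic_roots (c2 c1 c0 : R) : (c2, c1) != 0 ->
  countable [set x : R | c2 * x ^+ 2 + c1 * x + c0 = 0].
Proof.
move=> c0n; apply: finite_set_countable.
have [->|/set0P[x0 /= x0r]] :=
    eqVneq [set x : R | c2 * x ^+ 2 + c1 * x + c0 = 0] set0.
  exact: finite_set0.
(* By Vieta the other root is [- c1 / c2 - x0]. For [c2 = 0] this term is just [- x0], a harmless
   extra point. *)
apply: (@sub_finite_set _ _ [set x0; - c1 / c2 - x0]) => [x /= xr|].
  have /eqP : (x - x0) * (c2 * (x + x0) + c1) = 0 by lra.
  rewrite mulf_eq0 subr_eq0 => /orP[/eqP ->|/eqP e]; first by left.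
  right; have [c20|c2n] := eqVneq c2 0.
    move: e; rewrite c20 mul0r add0r => c10.
    by move: c0n; rewrite c20 c10 => /eqP/(_ erefl).
  have -> : c1 = - (c2 * (x + x0)) by lra.
  by field.
exact: finite_set2.
Qed.

(** Each pair of polynomials differing in one of the two higher coefficients excludes finitely many
    [x]. There are countably many pairs, and a countable set is null whereas the line is not. *)
Lemma exists_generic (I : countType) (c2 c1 c0 : I -> R) :
  exists x : R, forall i j,
    c2 i * x ^+ 2 + c1 i * x + c0 i = c2 j * x ^+ 2 + c1 j * x + c0 j ->
    c2 i = c2 j /\ c1 i = c1 j.
Proof.
pose bad := \bigcup_(ij in [set ij : I * I |
    (c2 ij.1 - c2 ij.2, c1 ij.1 - c1 ij.2) != 0])
  [set x : R | (c2 ij.1 - c2 ij.2) * x ^+ 2 + (c1 ij.1 - c1 ij.2) * x +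
    (c0 ij.1 - c0 ij.2) = 0].
have bad0 : countable bad.
  apply: bigcup_countable => // ij; exact: countable_quadratic_roots.
have [x xgood] : exists x, ~ bad x.
  apply/not_existsP => allbad.
  have badT : bad = setT.
    by apply/seteqP; split => // x _; have /contrapT := allbad x.
  have := countable_lebesgue_measure0 bad0.
  rewrite badT -set_itvNyy.
  by rewrite lebesgue_measure_itv.
exists x => i j e.
have [/eqP|ne] := boolP ((c2 i - c2 j, c1 i - c1 j) == 0).
  by move=> [/eqP + /eqP]; rewrite !subr_eq0 => /eqP -> /eqP ->.
by exfalso; apply: xgood; exists (i, j) => //=; lra.
Qed.

End Generic.

(** * The sequence of cells of a strip *)

Section Rotation.
Variable R : realType.
Local Notation w := (sqrt5 R).

(** In [5 m^2 = n^2] with [m] nonzero, the exponent of 5 is odd on the left and even on the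
    right. *)
Lemma sqrt5_irrational (m n : int) : m%:~R * w = n%:~R -> m = 0.
Proof.
move=> e; apply/eqP; apply: contraT => m0.
have : (5 * `|m| ^ 2 = `|n| ^ 2)%N.
  apply/eqP; rewrite -(eqr_nat R) natrM !natrX !natr_absz !intr_norm.
  rewrite !real_normK ?num_real// -e exprMn.
  by rewrite [w ^+ 2]expr2 sqrt5_sq mulrC.
move=> /(congr1 (logn 5)); rewrite lognM ?expn_gt0 ?absz_gt0 ?m0//.
rewrite !lognX (_ : logn 5 5 = 1%N)// => /(congr1 odd).
by rewrite oddD !oddM.
Qed.

(* Cell [i] is a trapezoid exactly when [long_count] jumps at [i], so that the
   density of trapezoids is [1 / (1 + sqrt5)], which balances the changes [- 1]
   and [+ sqrt5] of [slope], the rise of the segment before cell [i]. *)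
Definition long_count (i : int) : int := Num.floor (i%:~R / (1 + w)).

Definition slope (i : int) : R := (1 + w) * (long_count i)%:~R - i%:~R.

(** On the left wall each triangular cell takes length 1 and each trapezoid [short_base]; both
    counts are signed, going negative below cell 0. *)
Definition left_end (i : int) : R :=
  i%:~R - (long_count i)%:~R + short_base R * (long_count i)%:~R.

(** These are the floor inequalities multiplied by [1 + sqrt5]. They keep the shears, and with them
    the perimeters, bounded. *)
Lemma slope_bounds i : - (1 + w) < slope i <= 0.
Proof.
have /andP[w0 w1] := sqrt5_bounds R.
have L0 : 0 < 1 + w by lra.
have := floor_le (i%:~R / (1 + w)); have := floorD1_gt (i%:~R / (1 + w)).
rewrite -/(long_count i) ler_pdivlMr// ltr_pdivrMr// intrD /slope => h1 h2.
by apply/andP; split; lra.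
Qed.

Lemma slope_inj : injective slope.
Proof.
move=> i i' e.
have : (long_count i - long_count i')%:~R * w =
    ((i - i') - (long_count i - long_count i'))%:~R.
  by rewrite !rmorphB/=; move: e; rewrite /slope; lra.
move=> /sqrt5_irrational/eqP; rewrite subr_eq0 => /eqP me.
by move: e; rewrite /slope me => /addrI/oppr_inj/intr_inj.
Qed.

Lemma long_count_step i :
  long_count (i + 1) = long_count i \/ long_count (i + 1) = long_count i + 1.
Proof.
have /andP[w0 w1] := sqrt5_bounds R.
have /andP[a1 a2] := slope_bounds i; have /andP[b1 b2] := slope_bounds (i + 1).
move: a1 a2 b1 b2; rewrite /slope intrD => a1 a2 b1 b2.
have : long_count i < long_count (i + 1) + 1.
  by rewrite -(ltr_int R) intrD; nra.
have : long_count (i + 1) < long_count i + 2.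
  by rewrite -(ltr_int R) intrD; nra.
lia.
Qed.

Definition edge (i : int) (h : R) : R := left_end i + slope i / 2 * h.

Definition triangular (i : int) : bool := long_count (i + 1) == long_count i.

Lemma edge_step i h : edge (i + 1) h - edge i h = cell_width (triangular i) h.
Proof.
rewrite /edge /left_end /slope /triangular /cell_width !intrD.
have [e|/eqP] := eqVneq; first by rewrite e; lra.
case: (long_count_step i) => [->//|-> _].
by rewrite intrD /short_base; lra.
Qed.

Lemma edge_homo i (n : nat) h : 0 <= h <= 2 -> edge i h <= edge (i + n%:Z) h.
Proof.
move=> h02; elim: n => [|n IH]; first by rewrite addr0.
rewrite (le_trans IH)// -addn1 PoszD addrA -subr_ge0 edge_step.
exact: cell_width_ge0.
Qed.

(** As [short_base] exceeds 1, [left_end n] is at least [n]; across the strip the edge drops by at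
    most [1 + sqrt5], which is below 4. *)
Lemma edge_ge (n : nat) h : 0 <= h <= 2 -> n%:R - 4 <= edge n h.
Proof.
move=> /andP[h0 h2]; have /andP[w0 w1] := sqrt5_bounds R.
have /andP[s0 s1] := slope_bounds n.
have m0 : 0 <= (long_count n)%:~R :> R.
  by rewrite ler0z floor_ge0 divr_ge0//; lra.
rewrite /edge /left_end /short_base -[n%:~R]/(n%:R).
have : - 4 <= slope n / 2 * h by nra.
by nra.
Qed.

Lemma edge_le (n : nat) h : 0 <= h <= 2 -> edge (- n%:Z) h <= - n%:R.
Proof.
move=> /andP[h0 h2]; have /andP[w0 w1] := sqrt5_bounds R.
have /andP[s0 s1] := slope_bounds (- n%:Z).
have m0 : (long_count (- n%:Z))%:~R <= 0 :> R.
  rewrite (le_trans (floor_le _))// mulrNz mulNr oppr_le0 divr_ge0//; lra.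
rewrite /edge /left_end /short_base mulrNz -[n%:~R]/(n%:R).
have : slope (- n%:Z) / 2 * h <= 0 by nra.
by nra.
Qed.

Lemma edge_cover h x : 0 <= h <= 2 -> exists i, edge i h <= x < edge (i + 1) h.
Proof.
move=> h02.
pose N := Num.bound `|x|.
have xN : `|x| < N%:R by exact: archi_boundP.
have lo : edge (- N%:Z) h <= x.
  rewrite (le_trans (edge_le _ h02))//.
  by move: xN; rewrite ltr_norml => /andP[? _]; lra.
have : exists n, x < edge (- N%:Z + n%:Z) h.
  (* This reaches the edge of index [N + 4], whose height is at least [N] and so exceeds [x]. *)
  exists (N + (N + 4))%N; rewrite PoszD addKr.
  rewrite (lt_le_trans _ (edge_ge _ h02))// natrD.
  by move: xN; rewrite ltr_norml => /andP[_ ?]; lra.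
move=> /ex_minnP[[|n] xn nmin].
  by move: xn; rewrite addr0 ltNge lo.
exists (- N%:Z + n%:Z); rewrite -addrA -PoszD addn1 xn andbT leNgt.
by apply/negP => /nmin; rewrite ltnn.
Qed.

End Rotation.

(** * The tiles *)

Section Tiles.
Variables (R : realType) (theta : R).
Implicit Types (k i : int) (j l : nat) (p v : R * R).

(* The factors are distinct, and [strip_factor k ^+ 2 <= 121 / 100] is smaller
   than all ratios of leading coefficients bounded in [sq_coef2_gap]. *)
Definition strip_factor k : R := 1 + (10 + (pickle k)%:R)^-1.

(** The rise [slope] is spread over the width 2, hence the half; the second term is the shear of the
    whole strip. *)
Definition total_shear k i : R := slope R i / 2 + strip_factor k * theta.

Definition place k i : R * R -> R * R :=
  shear (2 * k%:~R) (left_end R i) (total_shear k i).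

Definition tile k i j : set (R * R) :=
  triangle (place k i (vertex R j 0)) (place k i (vertex R j 1))
    (place k i (vertex R j 2)).

Definition valid i j : Prop := (j < 6)%N /\ (j == 0%N) = triangular R i.

Lemma orient_place k i j : (j < 6)%N ->
  orient (place k i (vertex R j 0)) (place k i (vertex R j 1))
    (place k i (vertex R j 2)) = 2.
Proof. by move=> j6; rewrite orient_shear orient_vertex. Qed.

Lemma strip_factor_bounds k : 1 < strip_factor k <= 11 / 10.
Proof.
have p0 : 0 <= (pickle k)%:R :> R by [].
have p1 : 0 < 10 + (pickle k)%:R :> R by lra.
rewrite /strip_factor ltrDl invr_gt0 p1/=.
have : (10 + (pickle k)%:R)^-1 <= 10^-1 :> R.
  by rewrite lef_pV2 ?posrE//; lra.
by lra.
Qed.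

Lemma strip_factor_inj : injective strip_factor.
Proof.
move=> k k' /addrI /invr_inj /addrI /eqP; rewrite eqr_nat => /eqP.
exact: (pcan_inj pickleK).
Qed.

(** A floor finds the strip; undoing the shear of the strip finds the cell; subtracting the lower
    edge of the cell finds the piece. *)
Lemma tile_cover p : exists k i j, valid i j /\ tile k i j p.
Proof.
pose k := Num.floor (p.1 / 2).
have k1 : k%:~R <= p.1 / 2 := floor_le _.
have k2 : p.1 / 2 < k%:~R + 1 by have := floorD1_gt (p.1 / 2); rewrite intrD.
pose h := p.1 - 2 * k%:~R.
have h02 : 0 <= h <= 2 by rewrite /h; apply/andP; split; lra.
pose x := p.2 - strip_factor k * theta * h.
have [i /andP[i1 i2]] := edge_cover x h02.
have x0 : 0 <= x - edge i h <= cell_width (triangular R i) h.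
  by rewrite -edge_step; apply/andP; split; lra.
have [j [j6 je jp]] := @cell_cover R (triangular R i) (h, x - edge i h) h02 x0.
exists k, i, j; split=> //.
have -> : p = place k i (h, x - edge i h).
  rewrite [LHS]surjective_pairing /place /shear /total_shear /edge /x /h/=.
  by congr pair; field.
by apply: triangle_shear; rewrite ?orient_vertex ?pnatr_eq0.
Qed.

Lemma tiles_separated k i j k' i' j' (u v w : R) : (u, v) != 0 ->
  (forall l, 0 <= u * (place k i (vertex R j l)).1 +
    v * (place k i (vertex R j l)).2 + w) ->
  (forall l, u * (place k' i' (vertex R j' l)).1 +
    v * (place k' i' (vertex R j' l)).2 + w <= 0) ->
  interior (tile k i j) `&` interior (tile k' i' j') = set0.
Proof.
move=> uv h h'; apply: (separated_interior uv).
  exact: (@triangle_sub_halfplane _ _ _ _ u v w).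
have hN l : 0 <= - u * (place k' i' (vertex R j' l)).1 +
    - v * (place k' i' (vertex R j' l)).2 + - w.
  by have := h' l; lra.
exact: (@triangle_sub_halfplane _ _ _ _ (- u) (- v) (- w)).
Qed.

Lemma tiles_interior_strips k i j k' i' j' : (j < 6)%N -> (j' < 6)%N ->
  k < k' -> interior (tile k i j) `&` interior (tile k' i' j') = set0.
Proof.
move=> j6 j6' kk'.
have kk1 : k%:~R + 1 <= k'%:~R :> R by rewrite -[1]/(1%:~R) -intrD ler_int; lia.
apply: (@tiles_separated _ _ _ _ _ _ (- 1) 0 (2 * k'%:~R)).
- by rewrite pair_neq0 oppr_eq0 oner_eq0.
- by move=> l; have [_ ? _ _] := @vertex_cell R j l j6; rewrite /=; lra.
- by move=> l; have [? _ _ _] := @vertex_cell R j' l j6'; rewrite /=; lra.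
Qed.

Lemma tiles_interior_cells k i j i' j' : valid i j -> valid i' j' ->
  i < i' -> interior (tile k i j) `&` interior (tile k i' j') = set0.
Proof.
move=> [j6 je] [j6' je'] ii'.
have [n i'E] : exists n : nat, i' = i + 1 + n%:Z.
  by exists (absz (i' - (i + 1))%R); lia.
(* The separating line is the lower edge of cell [i + 1], of slope [s] after the shear of the strip.
   Monotonicity of the edges puts cell [i'] above it. *)
pose s := slope R (i + 1) / 2 + strip_factor k * theta.
apply: (@tiles_separated _ _ _ _ _ _ s (- 1)
    (left_end R (i + 1) - s * (2 * k%:~R))).
- by rewrite pair_neq0 oppr_eq0 oner_eq0 orbT.
- move=> l; have [_ _ _] := @vertex_cell R j l j6.
  rewrite je -edge_step /edge /s /place /shear /total_shear/=; lra.
- move=> l; have [h0 h2 x0 _] := @vertex_cell R j' l j6'.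
  have h02 : 0 <= (vertex R j' l).1 <= 2 by rewrite h0.
  have := @edge_homo R (i + 1) n _ h02.
  move: x0; rewrite -i'E /edge /s /place /shear /total_shear/=; lra.
Qed.

Lemma tiles_interior_pieces k i j j' : valid i j -> valid i j' ->
  (j < j')%N -> interior (tile k i j) `&` interior (tile k i j') = set0.
Proof.
move=> [j6 je] [j6' je'] jj'.
(* Piece 0 and a fan piece cannot both be valid in cell [i], as they require opposite values of
   [triangular R i]. *)
case: j j' je je' jj' j6 j6' => [|j] [|j'] //; first by move=> <-.
move=> _ _ jj' j6 j6'.
have sep l := @fan_separation R j j' l jj' j6'.
pose P := place k i (fan_apex R); pose F := place k i (fan_point R j.+1).
have uE p : - (F.2 - P.2) * p.1 + (F.1 - P.1) * p.2 +
    ((F.2 - P.2) * P.1 - (F.1 - P.1) * P.2) = orient P F p.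
  by rewrite /orient; ring.
apply: (@tiles_separated _ _ _ _ _ _ (- (F.2 - P.2)) (F.1 - P.1)
    ((F.2 - P.2) * P.1 - (F.1 - P.1) * P.2)).
- rewrite pair_neq0; apply/orP; right.
  rewrite (_ : F.1 - P.1 = (fan_point R j.+1).1 - (fan_apex R).1).
    exact: fan_apex_neq.
  by rewrite /F /P /=; ring.
- by move=> l; rewrite uE orient_shear; have [] := sep l.
- by move=> l; rewrite uE orient_shear; have [] := sep l.
Qed.

Lemma tiles_interior k i j k' i' j' : valid i j -> valid i' j' ->
  (k, i, j) <> (k', i', j') ->
  interior (tile k i j) `&` interior (tile k' i' j') = set0.
Proof.
move=> va va' ne; have [j6 _] := va; have [j6' _] := va'.
have [kk|kk|ek] := ltgtP k k'.
- exact: tiles_interior_strips.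
- by rewrite setIC; exact: tiles_interior_strips.
have [ii|ii|ei] := ltgtP i i'; rewrite -?ek.
- exact: tiles_interior_cells.
- by rewrite setIC; exact: tiles_interior_cells.
have [jj|jj|ej] := ltngtP j j'; rewrite -?ei.
- by apply: tiles_interior_pieces; rewrite // ei.
- by rewrite setIC; apply: tiles_interior_pieces; rewrite // ei.
by case: ne; rewrite ek ei ej.
Qed.

Lemma total_shear_le k i : `|total_shear k i| <= 2 + 2 * `|theta|.
Proof.
have /andP[w0 w1] := sqrt5_bounds R; have /andP[s0 s1] := slope_bounds R i.
have /andP[r0 r1] := strip_factor_bounds k.
rewrite (le_trans (ler_normD _ _))// lerD//.
  by rewrite ler_norml; apply/andP; split; lra.
by rewrite normrM gtr0_norm ?ler_wpM2r//; lra.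
Qed.

Lemma tile_perimeter k i j : (j < 6)%N ->
  triangle_perimeter (place k i (vertex R j 0)) (place k i (vertex R j 1))
    (place k i (vertex R j 2)) <= 30 + 12 * `|theta|.
Proof.
move=> j6; have s := total_shear_le k i.
(* Each side is at most [6 + 2 * |s|] for a total shear [s] with [|s| <= 2 + 2 * |theta|]. *)
have d l l' : eucl_dist (place k i (vertex R j l)) (place k i (vertex R j l'))
    <= 10 + 4 * `|theta|.
  have c m : 0 <= (vertex R j m).1 <= 2 /\ 0 <= (vertex R j m).2 <= 4.
    have [h0 h2 x0 xw] := @vertex_cell R j m j6; rewrite h0 x0; split=> //.
    by rewrite (le_trans xw)// cell_width_le4// h0.
  have [] := (c l, c l') => -[c1 c2] [c3 c4].
  by apply: le_trans (eucl_dist_shear_le _ _ _ c1 c3 c2 c4) _; lra.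
rewrite /triangle_perimeter.
by have := d 0%N 1%N; have := d 1%N 2; have := d 2 0%N; lra.
Qed.

End Tiles.

(** * Recovering the tile from its coefficients *)

Lemma sq_coef2_neq0 (R : realType) j : (j < 6)%N -> sq_coef2 R j != 0.
Proof.
case: j => [|j] j6; last by rewrite gt_eqF//; have [] := @sq_coef2_gap R 0 j.+1.
have [] := @sq_coef2_gap R 0 1 isT isT; lra.
Qed.

(** Squared strip factors lie above 1 and at most at [121 / 100], so the ranges of the products for
    different pieces are disjoint. Once the piece is known, the factor identifies the strip. *)
Lemma sq_coef2_factor_inj (R : realType) j j' k k' : (j < 6)%N -> (j' < 6)%N ->
  sq_coef2 R j * strip_factor R k ^+ 2 =
    sq_coef2 R j' * strip_factor R k' ^+ 2 ->
  j = j' /\ k = k'.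
Proof.
have lt j1 j2 k1 k2 : (j1 < j2)%N -> (j2 < 6)%N ->
    sq_coef2 R j2 * strip_factor R k2 ^+ 2 <
      sq_coef2 R j1 * strip_factor R k1 ^+ 2.
  move=> j12 j26; have [a0 a1] := sq_coef2_gap R j12 j26.
  have /andP[r1 _] := strip_factor_bounds R k1.
  have /andP[r2 r2'] := strip_factor_bounds R k2.
  have : 1 <= strip_factor R k1 ^+ 2 by rewrite expr2; nra.
  have : strip_factor R k2 ^+ 2 <= 121 / 100 by rewrite expr2; nra.
  by nra.
move=> j6 j6' e; have [jj|jj|ej] := ltngtP j j'.
- by have := lt _ _ k k' jj j6'; rewrite e ltxx.
- by have := lt _ _ k' k jj j6; rewrite e ltxx.
split=> //; apply: (@strip_factor_inj R); move: e; rewrite -ej.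
move=> /(mulfI (sq_coef2_neq0 R j6))/eqP; rewrite eqrXn2//.
- by move=> /eqP.
- by have /andP[] := strip_factor_bounds R k; lra.
- by have /andP[] := strip_factor_bounds R k'; lra.
Qed.

Theorem theorem1 (R : realType) :
  exists (K : R) (TT : set (set (R * R))),
    [/\ 0 < K,
        tiling TT,
        (forall S T, TT S -> TT T -> S <> T -> ~ plane_congruent S T) &
        forall T, TT T ->
          exists a b c : R * R,
            [/\ noncollinear a b c,
                T = triangle a b c,
                area T = 1%:E &
                triangle_perimeter a b c <= K]].
Proof.
(* The next three are the coefficients in [theta] of the sum of squared sides of a tile, after
   substituting [total_shear] for the shear. *)
pose c2 (x : int * int * nat) : R :=
  let: (k, i, j) := x in sq_coef2 R j * strip_factor R k ^+ 2.
pose c1 (x : int * int * nat) : R :=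
  let: (k, i, j) := x in
  (sq_coef2 R j * slope R i + sq_coef1 R j) * strip_factor R k.
pose c0 (x : int * int * nat) : R :=
  let: (k, i, j) := x in
  sq_coef2 R j * (slope R i / 2) ^+ 2 + sq_coef1 R j * (slope R i / 2) +
  sq_coef0 R j.
have [theta gen] := exists_generic c2 c1 c0.
have D0 k i j : (j < 6)%N ->
    orient (place theta k i (vertex R j 0)) (place theta k i (vertex R j 1))
      (place theta k i (vertex R j 2)) != 0.
  by move=> j6; rewrite orient_place// pnatr_eq0.
exists (30 + 12 * `|theta|), [set T | exists k i j,
  valid R i j /\ T = tile theta k i j]; split.
- by rewrite ltr_wpDr ?mulr_ge0.
- split.
  + by move=> _ [k [i [j [[j6 _] ->]]]]; apply: closed_triangle; exact: D0.
  + apply/seteqP; split => // p _.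
    have [k [i [j [va tp]]]] := tile_cover theta p.
    by exists (tile theta k i j) => //; exists k, i, j.
  + move=> _ _ [k [i [j [va ->]]]] [k' [i' [j' [va' ->]]]] ne.
    by apply: tiles_interior => // -[ek ei ej]; apply: ne; rewrite ek ei ej.
- move=> _ _ [k [i [j [va ->]]]] [k' [i' [j' [va' ->]]]] ne cong; apply: ne.
  have [j6 _] := va; have [j6' _] := va'.
  have := congruent_sum_sq_sides (D0 k i j j6) (D0 k' i' j' j6') cong.
  rewrite !sum_sq_sides_shear /total_shear => e.
  have [|e2 e1] := gen (k, i, j) (k', i', j'); first by rewrite /=; lra.
  have [ej ek] := sq_coef2_factor_inj j6 j6' e2; subst j' k'.
  (* With [j] and [k] fixed, the linear coefficient is an injective affine function of [slope], and
     [slope] determines the cell. *)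
  move: e1 => /mulIf -/(_ _)/addIr/(mulfI (sq_coef2_neq0 R j6))/slope_inj -> //.
  by have /andP[] := strip_factor_bounds R k; lra.
- move=> _ [k [i [j [[j6 _] ->]]]].
  exists (place theta k i (vertex R j 0)), (place theta k i (vertex R j 1)),
    (place theta k i (vertex R j 2)); split => //.
  + by apply: noncollinear_orient; exact: D0.
  + by rewrite /tile area_triangle ?D0// orient_place// normr_nat divff.
  + exact: tile_perimeter.
Qed.
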